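(* Let $f:\mathbb{R}^n\to\mathbb{R}$ be convex and differentiable with $L$-Lipschitz gradient ($L>0$), let $g:\mathbb{R}^n\to\mathbb{R}\cup\{+\infty\}$ be proper and lower semi-continuous (not necessarily convex), let $F=f+g$, and assume that $\operatorname{argmin}F$ is nonempty and closed, with $F^\star=\min F>-\infty$. Suppose $F$ has the KL property with parameters $\theta\in\,]0,1]$, $C>0$: $$\operatorname{dist}(0,\partial F(x))\ge\frac1C(F(x)-F^\star)^{1-\theta}\qquad\text{for all }x\in\operatorname{dom}F\setminus\operatorname{argmin}F.$$ Let $\gamma>0$, $\alpha_k\in[0,1/2]$, and let $(x_k),(y_k)$ be generated by the proximal gradient algorithm with alternated inertia: for every even $k$, $$y_{k+1}\in\mathsf{T}_\gamma(x_k),\qquad x_{k+1}=y_{k+1}+\alpha_k(y_{k+1}-y_k),\qquad y_{k+2}\in\mathsf{T}_\gamma(x_{k+1}),\qquad x_{k+2}=y_{k+2}.$$ For $k\ge1$ put $a_k=\frac{(1-\alpha_{2k}-\gamma L)\gamma}{2(1+\gamma L)^2}$, $s_k=\sum_{1\le\ell\le k}\min(a_\ell,2C^2)$, $C'=\liminf_k s_k/k^{1-d}$, $C''=\liminf_k s_k/\log(k)$. Then in each of the following three regimes $F(y_{2k})$ converges to $F^\star$, and $F(y_{2k})-F^\star$ satisfies: (a) if $\gamma<1/(2L)$ (and any $\alpha_k\le1/2$), or if $\gamma=1/(2L)$ and $\alpha_k\le\alpha<1/2$ for all $k$ (in both cases let $a>0$ be such that $a_k\ge a$ for all $k$): $\mathcal{O}\left(k^{-\left(1+\frac{2\theta}{1-2\theta}\right)}\right)$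 for $\theta\in\,]0,0.5[$; $\;\mathcal{O}\left(\left[\frac{C^2}{C^2+a}\right]^k\right)$ for $\theta\in[0.5,1[$; finite convergence for $\theta=1$; (b) if $\gamma=1/(2L)$ and $(\alpha_k)$ converges to $1/2$ at rate $1/k^d$ with $d\in\,]0,1[$: $\mathcal{O}\left(k^{-\left(1+\frac{2\theta-d}{1-2\theta}\right)}\right)$ for $\theta\in\,]0,0.5[$; $\;\mathcal{O}\left(\exp\left(-\frac{C'}{2C^2}k^{1-d}\right)\right)$ for $\theta\in[0.5,1[$; finite convergence for $\theta=1$; (c) if $\gamma=1/(2L)$ and $(\alpha_k)$ converges to $1/2$ at rate $1/k$: $\mathcal{O}\left(\log(k)^{-\frac{1}{1-2\theta}}\right)$ for $\theta\in\,]0,0.5[$; $\;\mathcal{O}\left(k^{-\frac{C''}{2C^2}}\right)$ for $\theta\in[0.5,1[$; finite convergence for $\theta=1$.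
   Context: $\|\cdot\|$ is the Euclidean norm. $\mathsf{T}_\gamma(x)=\mathbf{prox}_{\gamma g}(x-\gamma\nabla f(x))$ with $\mathbf{prox}_h(x)=\operatorname{argmin}_w\left(h(w)+\frac12\|w-x\|^2\right)$, which may be set-valued since $g$ may be non-convex; at each step any element is chosen. $\partial F$ is the limiting (Fréchet) subdifferential: the set of limits of $v_j$ where $v_j$ is a Fréchet subgradient of $F$ at $z_j$, $z_j\to x$, $F(z_j)\to F(x)$. $\operatorname{dist}(0,S)=\inf_{s\in S}\|s\|$ (with $\operatorname{dist}(0,\emptyset)=+\infty$). The algorithm starts from an arbitrary $x_0$ (and $y_0$). ''$(\alpha_k)$ converges to $1/2$ at rate $1/k^d$'' means that there are constants $0<c_1\le c_2$ with $c_1/k^d\le \frac12-\alpha_k\le c_2/k^d$ for all large $k$ (and $d=1$ for rate $1/k$). ''Finite convergence'' means $F(y_{2k})=F^\star$ for all sufficiently large $k$. *)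

(* Defs.v *)
From mathcomp Require Import all_boot all_order all_algebra.
From mathcomp Require Import all_classical all_reals all_analysis.
Set Implicit Arguments.
Unset Strict Implicit.
Unset Printing Implicit Defensive.
Import Order.TTheory GRing.Theory Num.Theory.
Import numFieldNormedType.Exports.
Local Open Scope classical_set_scope.
Local Open Scope ring_scope.

Section Euclidean.
Context {R : realType} {n : nat}.
Implicit Types (u v x z : 'rV[R]_n).

Definition dot u v : R := \sum_(i < n) u 0 i * v 0 i.

(* The library norm `|u| on 'rV[R]_n is the maximum norm; it induces the same
   topology, hence the same limits, neighborhoods and derivatives. *)
Definition enorm u : R := Num.sqrt (dot u u).

Definition gradient (f : 'rV[R]_n -> R) x : 'rV[R]_n :=
  \row_(i < n) 'D_(delta_mx 0 i) f x.

Definition lipschitz_gradient (f : 'rV[R]_n -> R) (L : R) : Prop :=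
  forall x z, enorm (gradient f x - gradient f z) <= L * enorm (x - z).

Local Open Scope ereal_scope.

Definition proper_fun (g : 'rV[R]_n -> \bar R) : Prop :=
  (forall x, g x != -oo) /\ (exists x, g x < +oo).

Definition objective (f : 'rV[R]_n -> R) (g : 'rV[R]_n -> \bar R) x : \bar R :=
  (f x)%:E + g x.

Definition argmin (h : 'rV[R]_n -> \bar R) : set 'rV[R]_n :=
  [set x | forall z, h x <= h z].

Definition prox (h : 'rV[R]_n -> \bar R) x : set 'rV[R]_n :=
  argmin (fun w => h w + (2^-1 * enorm (w - x) ^+ 2)%:E).

Definition prox_grad (gamma : R) (f : 'rV[R]_n -> R) (g : 'rV[R]_n -> \bar R) x
    : set 'rV[R]_n :=
  prox (fun w => gamma%:E * g w) (x - gamma *: gradient f x)%R.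

(* F w >= F z + <v, w - z> - o(||w - z||) as w tends to z, z in dom F *)
Definition frechet_subdiff (F : 'rV[R]_n -> \bar R) z : set 'rV[R]_n :=
  [set v | F z \is a fin_num /\
    forall eps : R, (0 < eps)%R -> \forall w \near z,
      F z + (dot v (w - z) - eps * enorm (w - z))%:E <= F w].

Definition limiting_subdiff (F : 'rV[R]_n -> \bar R) x : set 'rV[R]_n :=
  [set v | exists z_ v_ : nat -> 'rV[R]_n,
    [/\ forall j, frechet_subdiff F (z_ j) (v_ j),
        z_ j @[j --> \oo] --> x,
        F (z_ j) @[j --> \oo] --> F x &
        v_ j @[j --> \oo] --> v]].

(* equal to +oo when S is empty *)
Definition dist0 (S : set 'rV[R]_n) : \bar R :=
  ereal_inf [set (enorm s)%:E | s in S].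

Definition KL_property (F : 'rV[R]_n -> \bar R) (Fstar theta C : R) : Prop :=
  forall x, F x < +oo -> ~ argmin F x ->
    (C^-1 * (fine (F x) - Fstar) `^ (1 - theta))%:E
      <= dist0 (limiting_subdiff F x).

Definition alternated_inertia (gamma : R) (alpha : nat -> R)
    (f : 'rV[R]_n -> R) (g : 'rV[R]_n -> \bar R) (x y : nat -> 'rV[R]_n)
    : Prop :=
  forall k, ~~ odd k ->
    [/\ prox_grad gamma f g (x k) (y k.+1),
        x k.+1 = (y k.+1 + alpha k *: (y k.+1 - y k))%R,
        prox_grad gamma f g (x k.+1) (y k.+2) &
        x k.+2 = y k.+2].

End Euclidean.

Section Rates.
Context {R : realType}.
Implicit Types (gamma L C d : R) (alpha : nat -> R).

Definition converges_half_at_rate alpha d : Prop :=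
  exists c1 c2 : R, [/\ 0 < c1, c1 <= c2 &
    \forall k \near \oo,
      c1 / k%:R `^ d <= 2^-1 - alpha k <= c2 / k%:R `^ d].

Definition acoef gamma L alpha (k : nat) : R :=
  (1 - alpha k.*2 - gamma * L) * gamma / (2 * (1 + gamma * L) ^+ 2).

Definition scoef gamma L C alpha (k : nat) : R :=
  \sum_(1 <= l < k.+1) Num.min (acoef gamma L alpha l) (2 * C ^+ 2).

(* limn_inf is the liminf of a bounded sequence; both quotients below are
   bounded when alpha tends to 1/2 at rate 1/k^d, respectively 1/k. *)
Definition Cprime gamma L C alpha d : R :=
  limn_inf (fun k => scoef gamma L C alpha k / k%:R `^ (1 - d)).

Definition Csecond gamma L C alpha : R :=
  limn_inf (fun k => scoef gamma L C alpha k / ln k%:R).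

End Rates.

(* Main.v *)
Require Import Defs.
From mathcomp Require Import all_boot all_order all_algebra.
From mathcomp Require Import all_classical all_reals all_analysis.
From mathcomp Require Import ring lra.
Import Order.TTheory GRing.Theory Num.Theory.
Import numFieldNormedType.Exports.
Set Implicit Arguments.
Unset Strict Implicit.
Unset Printing Implicit Defensive.
Local Open Scope classical_set_scope.
Local Open Scope ring_scope.

(** The proof rests on a sufficient decrease of [F] over one double step
    [u -> v -> z = v + alpha (v - u) -> w].

    Optimality of [w] in the proximal problem at [z], the convexity inequality
    for [f] at [z] and the descent lemma between [z] and [w] give, for every
    [q] in the domain of [F],
      F(w) + (1/(2 gamma) - L/2) |w - z|^2 <= F(q) + 1/(2 gamma) |q - z|^2
    ([prox_grad_descent]).  Taking [q = v] for the step from [z], and [q = u]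
    for the step from [u], the term [alpha^2 |v - u|^2 / (2 gamma)] lost in the
    extrapolation is absorbed by the decrease of the first step, because
    [alpha^2 + gamma L <= 1/4 + 1/2 <= 1] ([inertial_descent]).  The decrease
    [(1 - gamma L)/(2 gamma) |w - z|^2] that remains does not depend on
    [alpha].

    On the other hand [grad f(w) - grad f(z) - (w - z)/gamma] is a subgradient
    of [F] at [w], of norm at most [(L + 1/gamma) |w - z|], so the KL
    inequality turns the decrease into a recurrence
      E_{k+1} + b E_{k+1}^(2 (1 - theta)) <= E_k     as long as E_{k+1} > 0
    for [E_k = F(y_{2k}) - Fstar], with [b = A / C^2] and
    [A = decrease_coef gamma L >= a_k] for all [k] ([kl_recurrence],
    [KL_inertial_step], [iterate_kl_recurrence]).  This recurrence alone forces
    [E_k -> 0], with [E_k] eventually zero if [theta = 1], geometric of ratio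
    [1 / (1 + b)] if [1/2 <= theta < 1], and [O(k^(-1/(1 - 2 theta)))] if
    [theta < 1/2].

    Since [A] bounds every [a_k], these are the rates of regime (a) for any
    admissible [a].  In regimes (b) and (c) they imply the stated ones:
    a geometric sequence is eventually below [exp(- c k^(1 - d))] and
    [k^(- c)] whatever the real constant [c] is, in particular for the
    constants built from [C'] and [C'']; and [k^(-1/(1 - 2 theta))] is below
    [k^(-(1 - d)/(1 - 2 theta))] and [log(k)^(-1/(1 - 2 theta))]. *)

(** * Comparison of rates *)

Section Domination.
Context {R : realType}.
Implicit Types (E e : nat -> R).

Definition near_dominated E e : Prop :=
  exists2 M : R, 0 <= M & \forall k \near \oo, 0 <= E k <= M * e k.

Lemma near_dominated_eqO E e e' : near_dominated E e ->
  (\forall k \near \oo, e k <= e' k) -> E =O_\oo e'.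
Proof.
move=> [M M0 EM] ee'; apply/eqO_exP; exists (M + 1); first by rewrite ltr_wpDl.
near=> k.
have /andP[E0 Ek] : 0 <= E k <= M * e k by near: k.
have ek : e k <= `|e' k| by rewrite (le_trans _ (ler_norm _))//; near: k.
rewrite ger0_norm// (le_trans Ek)// (le_trans (ler_wpM2l M0 ek))//.
by rewrite ler_wpM2r// lerDl.
Unshelve. all: by end_near. Qed.

(** With [r = exp(ln r)], the claim is [c k^(1 - d) <= k (- ln r)], that is
    [c / (- ln r) <= k^d], which holds eventually for any real [c]. *)
Lemma geometric_le_expR_powR (r c d : R) : 0 < r < 1 -> 0 < d ->
  \forall k \near \oo, r ^+ k <= expR (- (c * k%:R `^ (1 - d))).
Proof.
move=> /andP[r0 r1] d0; have lr : 0 < - ln r by rewrite oppr_gt0 ln_lt0// r0.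
near=> k.
have k0 : (0 : R) < k%:R by near: k; exact: nbhs_infty_gtr.
have kc : (`|c| / - ln r) `^ d^-1 <= k%:R by near: k; exact: nbhs_infty_ger.
have {}kc : `|c| / - ln r <= k%:R `^ d.
  rewrite (_ : `|c| / - ln r = (`|c| / - ln r) `^ d^-1 `^ d).
    by rewrite ge0_ler_powR ?nnegrE ?powR_ge0// ltW.
  by rewrite -powRrM mulVf ?gt_eqF// powRr1// divr_ge0// ltW.
have -> : r ^+ k = expR (k%:R * ln r) by rewrite expRM_natl lnK.
rewrite ler_expR lerNr.
rewrite powRB ?(gt_eqF k0) ?implybT// powRr1 ?(ltW k0)// -mulrN mulrCA.
rewrite ler_wpM2l ?(ltW k0)//.
rewrite ler_pdivrMr ?powR_gt0//.
by rewrite (le_trans (ler_norm c))// mulrC -ler_pdivrMr.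
Unshelve. all: by end_near. Qed.

(** The case [d = 1/2] of the previous comparison suffices, because
    [ln k <= 2 k^(1/2)]. *)
Lemma geometric_le_powRN (r c : R) : 0 < r < 1 ->
  \forall k \near \oo, r ^+ k <= k%:R `^ (- c).
Proof.
move=> r01; near=> k.
have k1 : (1 : R) < k%:R by near: k; exact: nbhs_infty_gtr.
have k0 : (0 : R) < k%:R by exact: lt_trans k1.
have : r ^+ k <= expR (- ((2 * `|c|) * k%:R `^ (1 - 2^-1))).
  by near: k; apply: geometric_le_expR_powR; rewrite ?invr_gt0.
move=> /le_trans; apply; rewrite [leRHS]/powR gt_eqF// ler_expR mulNr lerN2.
rewrite (_ : 1 - 2^-1 = 2^-1); last by field.
rewrite (@le_trans _ _ (`|c| * ln k%:R))//.
  by rewrite ler_wpM2r ?ler_norm// ltW// ln_gt0.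
rewrite [2 * _]mulrC -mulrA ler_wpM2l//.
have := ln_sublinear (powR_gt0 2^-1 k0); rewrite ln_powR => /ltW.
by rewrite mulrC ler_pdivrMr// mulrC.
Unshelve. all: by end_near. Qed.

Lemma powRN_le_ln (p : R) : 0 < p ->
  \forall k \near \oo, (k%:R : R) `^ (- p) <= ln k%:R `^ (- p).
Proof.
move=> p0; near=> k.
have k1 : (1 : R) < k%:R by near: k; exact: nbhs_infty_gtr.
have k0 : (0 : R) < k%:R by exact: lt_trans k1.
have lk0 : 0 < ln k%:R :> R by exact: ln_gt0.
rewrite !powRN lef_pV2 ?posrE ?powR_gt0//.
by rewrite ge0_ler_powR ?nnegrE ?ltW// ln_sublinear.
Unshelve. all: by end_near. Qed.

End Domination.

(** * Sequences driven by a KL inequality *)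

Section KLRecurrence.
Context {R : realType}.
Implicit Types (E : nat -> R) (b q : R).

(** The index starts at 1, since [F] is only known to be finite at points
    produced by a proximal step: [F(y_0)] may be infinite.  The inequality is
    implicit (the power is that of the new value) because the KL inequality is
    used at the endpoint of the step. *)
Definition kl_recurrence E b q : Prop :=
  [/\ forall k, 0 <= E k.+1,
      forall k, E k.+2 <= E k.+1 &
      forall k, 0 < E k.+2 -> b * E k.+2 `^ q <= E k.+1 - E k.+2].

Lemma kl_recurrence_le E b b' q : b' <= b ->
  kl_recurrence E b q -> kl_recurrence E b' q.
Proof.
move=> bb' [E0 Emon EKL]; split=> // k /EKL; apply: le_trans.
by rewrite ler_wpM2r ?powR_ge0.
Qed.

(** If [E] stayed above [eps], every step would decrease it by at least
    [b eps^q], which is impossible for a nonnegative sequence. *)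
Lemma kl_recurrence_near_lt E b q (eps : R) : 0 < b -> 0 <= q -> 0 < eps ->
  kl_recurrence E b q -> \forall k \near \oo, E k < eps.
Proof.
move=> b0 q0 eps0 [E0 Emon EKL].
have Ehomo m n : (m <= n)%N -> E n.+1 <= E m.+1.
  move=> /subnKC <-; elim: (n - m)%N => [|i IH]; first by rewrite addn0.
  by rewrite addnS (le_trans (Emon _)).
have [N EN] : exists N, E N.+1 < eps.
  apply: contrapT => /forallNP Eeps.
  have {}Eeps k : eps <= E k.+1 by rewrite leNgt; apply/negP/Eeps.
  pose c := b * eps `^ q; have c0 : 0 < c by rewrite mulr_gt0 ?powR_gt0.
  have Edrop k : E k.+1 <= E 1%N - k%:R * c.
    elim: k => [|k IH]; first by rewrite mul0r subr0.
    have : c <= E k.+1 - E k.+2.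
      apply: le_trans (EKL _ _); last exact: lt_le_trans (Eeps _).
      by rewrite ler_pM2l// ge0_ler_powR ?nnegrE ?(ltW eps0).
    by rewrite -natr1 mulrDl mul1r; lra.
  have := truncnS_gt (E 1%N / c); rewrite ltr_pdivrMr// => Elt.
  by have := le_trans (E0 _) (Edrop (Num.trunc (E 1%N / c)).+1); lra.
exists N.+1 => // -[//|k] /= Nk; exact: le_lt_trans (Ehomo N k Nk) EN.
Qed.

Lemma kl_recurrence_cvg0 E b q : 0 < b -> 0 <= q ->
  kl_recurrence E b q -> E k @[k --> \oo] --> (0 : R).
Proof.
move=> b0 q0 KL; have [E0 _ _] := KL; apply/cvgrPdist_lt => eps eps0.
near=> k.
have k0 : (0 < k)%N by near: k; exact: nbhs_infty_gt.
rewrite sub0r normrN ger0_norm; first by near: k; exact: kl_recurrence_near_lt KL.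
by case: (k) k0.
Unshelve. all: by end_near. Qed.

(** For [q = 0] each step landing on a positive value costs at least [b], which
    is no longer affordable once [E < b]. *)
Lemma kl_recurrence_finite E b : 0 < b ->
  kl_recurrence E b 0 -> \forall k \near \oo, E k = 0.
Proof.
move=> b0 KL; have [E0 _ EKL] := KL.
have [N _ EN] := kl_recurrence_near_lt b0 (lexx 0) b0 KL.
exists N.+2 => // -[//|[//|k]] /=; rewrite !ltnS => Nk.
apply/eqP; rewrite eq_le E0 andbT leNgt; apply/negP => Ek0.
have := EKL _ Ek0; rewrite powRr0 mulr1.
by have := EN _ (leqW Nk); lra.
Qed.

(** Once [E <= 1] one has [E^q >= E], and the recurrence becomes linear:
    [(1 + b) E_{k+1} <= E_k]. *)
Lemma kl_recurrence_geometric E b q : 0 < b -> 0 <= q <= 1 ->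
  kl_recurrence E b q ->
  near_dominated E (fun k => (1 + b)^-1 ^+ k).
Proof.
move=> b0 /andP[q0 q1] KL; have [E0 _ EKL] := KL.
have b1 : 0 < 1 + b by rewrite ltr_wpDl.
have [N _ EN] := kl_recurrence_near_lt b0 q0 ltr01 KL.
have step k : (N <= k)%N -> E k.+2 * (1 + b) <= E k.+1.
  move=> Nk; have [Ek|Ek] := leP (E k.+2) 0.
    by rewrite (le_trans _ (E0 k))// mulr_le0_ge0// ltW.
  have : E k.+2 <= E k.+2 `^ q.
    by rewrite ger1_powR// Ek ltW// EN//= !leqW.
  by rewrite -(ler_pM2l b0); have := EKL _ Ek; lra.
exists (E N.+1 * (1 + b) ^+ N.+1).
  by rewrite mulr_ge0// exprn_ge0// ltW.
exists N.+1 => // -[//|k] /= Nk; rewrite E0 exprVn/=.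
rewrite ler_pdivlMr ?exprn_gt0//.
rewrite -(subnKC Nk); elim: (_ - _)%N => [|i IH]; first by rewrite addn0.
apply: le_trans IH; rewrite addnS exprS mulrA ler_wpM2r ?exprn_ge0 ?(ltW b1)//.
by rewrite addSn step// leq_addr.
Qed.

(** The chord bound for the convex function [(1 + t)^N] on [[0, 1]]. *)
Lemma bernoulli_unit (t : R) N : 0 <= t <= 1 ->
  (1 + t) ^+ N <= 1 + (2 ^+ N - 1) * t.
Proof.
move=> /andP[t0 t1]; elim: N => [|N IH]; first by rewrite !expr0; lra.
have p0 : (1 : R) <= 2 ^+ N by rewrite exprn_ege1// ler1n.
rewrite !exprS (le_trans (ler_wpM2l _ IH)) ?addr_ge0//.
have : 0 <= (2 ^+ N - 1) * (t * (1 - t)) by rewrite !mulr_ge0 ?subr_ge0.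
by lra.
Qed.

(** Induction on [E_k <= M k^(-p)] with [p = 1/s].  If the bound [B] at [k+1]
    failed, then [E_k > B (1 + b B^s)] with [B^s = M^s/(k+1)]; and this exceeds
    the bound at [k], namely [B (1 + 1/k)^p], because [(1 + 1/k)^p] is at most
    [1 + (2^N - 1)/k] for an integer [N >= p], and [M] is chosen so that
    [b M^s >= 2 (2^N - 1)]. *)
Lemma kl_recurrence_sublinear E b s : 0 < b -> 0 < s ->
  kl_recurrence E b (1 + s) ->
  near_dominated E (fun k => k%:R `^ (- s^-1)).
Proof.
move=> b0 s0 [E0 _ EKL].
set p := s^-1; have p0 : 0 < p by rewrite invr_gt0.
pose N := (Num.trunc p).+1; have pN : p <= N%:R by rewrite ltW// truncnS_gt.
have t0 : (1 : R) <= 2 ^+ N by rewrite exprn_ege1// ler1n.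
pose K := 2 * (2 ^+ N - 1) / b.
have K0 : 0 <= K by rewrite divr_ge0 ?(ltW b0)//; lra.
pose M := Num.max 1 (Num.max (E 1%N) (K `^ p)).
have M0 : 0 < M by rewrite lt_max ltr01.
have MK : K <= M `^ s.
  rewrite (_ : K = K `^ p `^ s); last by rewrite -powRrM mulVf ?gt_eqF// powRr1.
  by rewrite ge0_ler_powR ?nnegrE ?powR_ge0 ?(ltW s0) ?(ltW M0)// !le_max lexx !orbT.
exists M; first exact: ltW.
exists 1%N => // -[//|k] _ /=; rewrite E0/=.
elim: k => [|k IH].
  by rewrite powR1 mulr1 /M !le_max lexx orbT.
(* The bound is assumed to fail at [k+2], to contradict it at [k+1]. *)
rewrite leNgt; apply/negP => Elt.
have k0 : (0 : R) < k.+1%:R by rewrite ltr0n.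
have k1 : (0 : R) < k.+2%:R by rewrite ltr0n.
set B := M * k.+2%:R `^ (- p) in Elt.
have B0 : 0 < B by rewrite mulr_gt0// powR_gt0.
have Bs : B `^ s = M `^ s / k.+2%:R.
  rewrite powRM ?(ltW M0) ?powR_ge0// -powRrM mulNr mulVf ?gt_eqF//.
  by rewrite powR_inv1// ltW.
have step : B * (1 + b * (M `^ s / k.+2%:R)) < E k.+1.
  have := EKL _ (lt_trans B0 Elt).
  rewrite powRD; last by rewrite (gt_eqF (lt_trans B0 Elt)) implybT.
  rewrite powRr1; last by rewrite ltW// (lt_trans B0).
  have : B `^ s <= E k.+2 `^ s.
    by rewrite ge0_ler_powR ?nnegrE ?(ltW s0) ?(ltW Elt) ?(ltW B0) ?E0.
  rewrite Bs; set u := _ / _; set v := _ `^ s => uv.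
  have u0 : 0 <= u by rewrite divr_ge0 ?powR_ge0 ?ltW.
  have Buv : B * u <= E k.+2 * v by rewrite ler_pM// ltW.
  by move: (ler_wpM2l (ltW b0) Buv); lra.
have growth : (k.+2%:R / k.+1%:R) `^ p <= 1 + b * (M `^ s / k.+2%:R).
  have -> : k.+2%:R / k.+1%:R = 1 + k.+1%:R^-1 :> R.
    by rewrite -[in LHS]natr1 mulrDl mul1r divff// gt_eqF.
  have i0 : (0 : R) <= k.+1%:R^-1 by rewrite invr_ge0 ltW.
  have i1 : (k.+1%:R : R)^-1 <= 1 by rewrite invf_le1// ler1n.
  rewrite (le_trans (ler_powR _ pN)) ?lerDl// powR_mulrn ?addr_ge0//.
  rewrite (le_trans (bernoulli_unit _ _)) ?i0// lerD2l.
  rewrite mulrA ler_pdivlMr// mulrAC ler_pdivrMr//.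
  have bM : 2 * (2 ^+ N - 1) <= b * M `^ s by rewrite [leRHS]mulrC -ler_pdivrMr.
  apply: (@le_trans _ _ (2 * (2 ^+ N - 1) * k.+1%:R)); last first.
    by rewrite ler_wpM2r// ltW.
  rewrite [2 * _]mulrC -mulrA ler_wpM2l ?subr_ge0//.
  by rewrite -natrM ler_nat mulSn mul1n addSnnS leq_addl.
have : M * k.+1%:R `^ (- p) <= B * (1 + b * (M `^ s / k.+2%:R)).
  apply: le_trans (ler_wpM2l (ltW B0) growth).
  rewrite /B -mulrA ler_wpM2l ?(ltW M0)// powRM ?invr_ge0 ?ler0n//.
  rewrite mulrA -powRD; last by rewrite (gt_eqF k1) implybT.
  by rewrite addNr powRr0 mul1r -powR_inv1 ?(ltW k0)// -powRrM mulN1r.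
by move=> /(le_trans IH) /le_lt_trans /(_ step); rewrite ltxx.
Qed.

End KLRecurrence.

(** * Euclidean inner product and norm *)

Section EuclideanSpace.
Context {R : realType} {n : nat}.
Implicit Types (u v w : 'rV[R]_n) (a : R).

Lemma dotC u v : dot u v = dot v u.
Proof. by apply: eq_bigr => i _; rewrite mulrC. Qed.

Lemma dotDl u v w : dot (u + v) w = dot u w + dot v w.
Proof. by rewrite -big_split; apply: eq_bigr => i _; rewrite mxE mulrDl. Qed.

Lemma dotZl a u v : dot (a *: u) v = a * dot u v.
Proof. by rewrite mulr_sumr; apply: eq_bigr => i _; rewrite mxE mulrA. Qed.

Lemma dotNl u v : dot (- u) v = - dot u v.
Proof. by rewrite -scaleN1r dotZl mulN1r. Qed.

Lemma dotDr u v w : dot u (v + w) = dot u v + dot u w.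
Proof. by rewrite dotC dotDl !(dotC u). Qed.

Lemma dotZr a u v : dot u (a *: v) = a * dot u v.
Proof. by rewrite dotC dotZl dotC. Qed.

Lemma dotNr u v : dot u (- v) = - dot u v.
Proof. by rewrite dotC dotNl dotC. Qed.

Definition dotE := (dotDl, dotDr, dotNl, dotNr, dotZl, dotZr).

Lemma dotuu_ge0 u : 0 <= dot u u.
Proof. by apply: sumr_ge0 => i _; rewrite -expr2 sqr_ge0. Qed.

Lemma enorm_ge0 u : 0 <= enorm u.
Proof. exact: sqrtr_ge0. Qed.

Lemma sqr_enorm u : enorm u ^+ 2 = dot u u.
Proof. by rewrite sqr_sqrtr ?dotuu_ge0. Qed.

Lemma enorm_eq0 u : enorm u = 0 -> u = 0.
Proof.
move=> u0; have : dot u u = 0 by rewrite -sqr_enorm u0 expr0n.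
move=> /psumr_eq0P u2; apply/rowP => i; rewrite mxE; apply/eqP.
by rewrite -sqrf_eq0 expr2 u2// => j _; rewrite -expr2 sqr_ge0.
Qed.

(** Cauchy-Schwarz, from [0 <= | |v| u - |u| v |^2]. *)
Lemma dot_le_enorm u v : dot u v <= enorm u * enorm v.
Proof.
have [/enorm_eq0 ->|u0] := eqVneq (enorm u) 0.
  by rewrite -(scale0r 0) dotZl mul0r mulr_ge0 ?enorm_ge0.
have [/enorm_eq0 ->|v0] := eqVneq (enorm v) 0.
  by rewrite -(scale0r 0) dotZr mul0r mulr_ge0 ?enorm_ge0.
have uv0 : 0 < enorm u * enorm v by rewrite mulr_gt0// lt0r ?u0 ?v0 enorm_ge0.
have := dotuu_ge0 (enorm v *: u - enorm u *: v).
rewrite !dotE -!sqr_enorm (dotC v u) => H.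
by rewrite -(ler_pM2l uv0); lra.
Qed.

Lemma ler_enormD u v : enorm (u + v) <= enorm u + enorm v.
Proof.
rewrite -ler_sqr ?nnegrE ?addr_ge0 ?enorm_ge0// sqr_enorm !dotE -!sqr_enorm.
by rewrite (dotC v u); have := dot_le_enorm u v; lra.
Qed.

Lemma enormZ a u : enorm (a *: u) = `|a| * enorm u.
Proof.
by rewrite /enorm dotZl dotZr mulrA -expr2 sqrtrM ?sqr_ge0// sqrtr_sqr.
Qed.

Lemma enormN u : enorm (- u) = enorm u.
Proof. by rewrite -scaleN1r enormZ normrN1 mul1r. Qed.

(** Row vectors carry the topology of the maximum norm; a coordinatewise
    distance below [eps / (n+1)] makes the Euclidean distance
    smaller than [eps]. *)
Lemma near_enorm_lt w (eps : R) : 0 < eps ->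
  \forall q \near w, enorm (q - w) < eps.
Proof.
move=> eps0; pose e := eps / (n.+1)%:R.
have e0 : 0 < e by rewrite divr_gt0.
apply/nbhs_ballP; exists e => //= q [_ qw].
have coord i : `|(q - w) 0 i| <= e.
  by rewrite !mxE distrC ltW//; exact: qw.
rewrite -ltr_sqr ?nnegrE ?enorm_ge0 ?ltW// sqr_enorm.
have : dot (q - w) (q - w) <= \sum_(i < n) e ^+ 2.
  by apply: ler_sum => i _; rewrite -expr2 -real_normK ?num_real// ler_sqr ?nnegrE ?(ltW e0).
rewrite sumr_const card_ord -mulr_natl => /le_lt_trans; apply.
rewrite /e expr_div_n mulrA ltr_pdivrMr ?exprn_gt0// mulrC ltr_pM2l ?exprn_gt0//.
by rewrite -natrX ltr_nat -mulnn mulSn ltn_addr.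
Qed.

End EuclideanSpace.

(** * Smooth and convex functions *)

Section SmoothConvex.
Context {R : realType} {n : nat} (f : 'rV[R]_n -> R).

Lemma derive_gradient (z v : 'rV[R]_n) :
  differentiable f z -> 'D_v f z = dot (gradient f z) v.
Proof.
move=> df; rewrite deriveE// [in LHS](row_sum_delta v) linear_sum/=.
by apply: eq_bigr => i _; rewrite linearZ/= !mxE deriveE// mulrC.
Qed.

(** By convexity the difference quotients of [f] in the direction [q - z] are
    bounded by [f q - f z] for steps in [(0, 1)]; let the step tend to 0. *)
Lemma convex_gradient_le (z q : 'rV[R]_n) :
  convex_function [set: 'rV[R]_n] f -> differentiable f z ->
  f z + dot (gradient f z) (q - z) <= f q.
Proof.
move=> cf df; rewrite -derive_gradient// addrC -lerBrDr.
have /cvg_dnbhs_at_right fcvg : h^-1 *: ((f \o shift z) (h *: (q - z)) - f z)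
    @[h --> 0^'] --> 'D_(q - z) f z := diff_derivable df.
apply: (cvgr_to_le fcvg); near=> h.
have h0 : 0 < h by near: h; exact: nbhs_right_gt.
have h1 : h < 1 by near: h; exact: nbhs_right_lt.
have fh : f (h *: q + (1 - h) *: z) <= h * f q + (1 - h) * f z.
  by apply: (cf (Itv01 (ltW h0) (ltW h1)) q z); rewrite inE.
have -> : (f \o shift z) (h *: (q - z)) = f (h *: q + (1 - h) *: z).
  by rewrite /= scalerBl scale1r scalerBr addrA addrAC.
by rewrite /GRing.scale/= ler_pdivrMl//; lra.
Unshelve. all: by end_near. Qed.

(** The derivative along a line at [t] has literally the difference quotients
    of the directional derivative at [t *: v + z]. *)
Lemma is_derive_line (z v : 'rV[R]_n) (t : R) : differentiable f (t *: v + z) ->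
  is_derive t 1 (fun s : R => f (s *: v + z)) (dot (gradient f (t *: v + z)) v).
Proof.
move=> df; rewrite -derive_gradient//.
have E : (fun h : R => h^-1 *: (((fun s : R => f (s *: v + z)) \o shift t) (h *: 1)
          - f (t *: v + z))) =
   (fun h => h^-1 *: ((f \o shift (t *: v + z)) (h *: v) - f (t *: v + z))).
  apply/funext => h /=; congr (_ *: (f _ - _)).
  by rewrite [h *: 1]mulr1 scalerDl addrA.
apply: DeriveDef; last by rewrite /derive E.
by rewrite /derivable E; exact: diff_derivable.
Qed.

(** The mean value theorem on [0, 1] for
    [psi(s) = f(s v + z) - a s - b s^2], with [a = <grad f(z), v>] and
    [b = L |v|^2 / 2]: Cauchy-Schwarz and the Lipschitz bound make the
    derivative of [psi] nonpositive. *)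
Lemma descent_lemma (L : R) (z v : 'rV[R]_n) :
  (forall x, differentiable f x) -> lipschitz_gradient f L ->
  f (v + z) <= f z + dot (gradient f z) v + L / 2 * enorm v ^+ 2.
Proof.
move=> df fL.
pose a := dot (gradient f z) v; pose b := L / 2 * enorm v ^+ 2.
pose psi := (fun s : R => f (s *: v + z)) - (a *: id + b *: (id ^+ 2)) : R -> R.
have dpsi (t : R) : is_derive t 1 psi
    (dot (gradient f (t *: v + z)) v - (a *: 1 + b *: ((2%:R * t ^+ 1) *: 1))).
  have did : is_derive t 1 (id : R -> R) 1 := is_derive_id t 1.
  exact: (is_deriveB (is_derive_line (df _))
    (is_deriveD (is_deriveZ a did) (is_deriveZ b (is_deriveX 2 did)))).
have [|t /[!in_itv]/= /andP[t0 t1]] :=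
  @MVT R psi _ 0 1 ltr01 (fun t _ => dpsi t).
  by apply: derivable_within_continuous => t _; exact: ex_derive.
(* The formula for [psi'] uses the scaling of [R] as a module over itself. *)
have regE (c e : R) : c *: (e : R^o) = c * e by [].
rewrite /psi /= !fctE /= scale1r scale0r add0r !regE => psi01.
have grad_le : dot (gradient f (t *: v + z)) v - a <= 2 * b * t.
  rewrite -dotNl -dotDl (le_trans (dot_le_enorm _ _))//.
  rewrite (le_trans (ler_wpM2r (enorm_ge0 _) (fL _ _)))// addrK enormZ gtr0_norm//.
  by rewrite le_eqVlt; apply/orP; left; apply/eqP; rewrite /b; field.
by rewrite -/a -/b; lra.
Qed.

End SmoothConvex.

(** * The proximal gradient step *)

Section ProximalGradient.
Context {R : realType} {n : nat}.
Variables (f : 'rV[R]_n -> R) (g : 'rV[R]_n -> \bar R) (L gamma : R).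
Hypotheses (f_convex : convex_function [set: 'rV[R]_n] f)
  (f_diff : forall x, differentiable f x)
  (f_lip : lipschitz_gradient f L)
  (g_proper : proper_fun g) (gamma_gt0 : 0 < gamma).
Implicit Types (q u v w z : 'rV[R]_n).

Let F := objective f g.

Lemma prox_grad_fin_num z w : prox_grad gamma f g z w -> g w \is a fin_num.
Proof.
have [gNy [q gq]] := g_proper; move=> /(_ q).
have := gNy w; case: (g w) => [//| _|//].
have := gNy q; case: (g q) gq => [r| |]// _ _.
by rewrite gt0_muley ?lte_fin// addye// leye_eq.
Qed.

(** Completing the square, the objective minimized by a proximal gradient step
    is, up to the factor [gamma] and a constant, the sum of [g] and of the
    quadratic model of [f] at [z]. *)
Lemma prox_grad_le z w q : prox_grad gamma f g z w -> g q \is a fin_num ->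
  fine (g w) + dot (gradient f z) (w - z) + (2 * gamma)^-1 * enorm (w - z) ^+ 2
  <= fine (g q) + dot (gradient f z) (q - z)
     + (2 * gamma)^-1 * enorm (q - z) ^+ 2.
Proof.
move=> Tzw; have := prox_grad_fin_num Tzw; have := Tzw q.
case: (g w) (g q) => [gw| |]// [gq| |]// + _ _; rewrite /= lee_fin.
have expand p : 2^-1 * enorm (p - (z - gamma *: gradient f z)) ^+ 2 =
    gamma * (dot (gradient f z) (p - z) + (2 * gamma)^-1 * enorm (p - z) ^+ 2
             + gamma / 2 * enorm (gradient f z) ^+ 2).
  rewrite (_ : p - _ = (p - z) + gamma *: gradient f z); last first.
    by rewrite opprB [RHS]addrC addrCA.
  move: (p - z) (gradient f z) => r d.
  rewrite !sqr_enorm !dotE (dotC d r).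
  by field; rewrite gt_eqF.
by rewrite !expand -!mulrDr ler_pM2l//; lra.
Qed.

Lemma objective_fin_num q : (F q \is a fin_num) = (g q \is a fin_num).
Proof. by rewrite /F /objective fin_numD. Qed.

Lemma fine_objective q : g q \is a fin_num -> fine (F q) = f q + fine (g q).
Proof. by move=> gq; rewrite /F /objective fineD. Qed.

(** In [prox_grad_le], bound the linear model of [f] at [z] from above by
    convexity at [q], and from below by the descent lemma at [w]. *)
Lemma prox_grad_descent z w q : prox_grad gamma f g z w -> F q \is a fin_num ->
  fine (F w) + ((2 * gamma)^-1 - L / 2) * enorm (w - z) ^+ 2
  <= fine (F q) + (2 * gamma)^-1 * enorm (q - z) ^+ 2.
Proof.
move=> Tzw Fq; have gw := prox_grad_fin_num Tzw.
have gq : g q \is a fin_num by rewrite -objective_fin_num.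
have := prox_grad_le Tzw gq.
have := convex_gradient_le q f_convex (f_diff z).
have := descent_lemma z (w - z) f_diff f_lip; rewrite subrK.
by rewrite !fine_objective//; lra.
Qed.

(** Expanding [|q - z|^2] around [w] in [prox_grad_le] shows that the Fréchet
    inequality at [w] holds with error [|q - w|^2 / (2 gamma)], which is at
    most [eps |q - w|] as soon as [|q - w| < 2 gamma eps].  Constant sequences
    then show that this Fréchet subgradient is a limiting one. *)
Lemma prox_grad_subgradient z w : prox_grad gamma f g z w ->
  limiting_subdiff F w (gradient f w - gradient f z - gamma^-1 *: (w - z)).
Proof.
move=> Tzw; have gw := prox_grad_fin_num Tzw.
exists (fun=> w), (fun=> gradient f w - gradient f z - gamma^-1 *: (w - z)).
split; [|exact: cvg_cst..] => _; split; first by rewrite objective_fin_num.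
move=> eps eps0; have e0 : 0 < 2 * gamma * eps by rewrite !mulr_gt0.
apply: filterS (near_enorm_lt w e0) => q qw.
have [gq|gq] := boolP (g q \is a fin_num); last first.
  have [gNy _] := g_proper.
  rewrite {2}/F /objective; case: (g q) (gNy q) gq => // _ _.
  by rewrite addey// leey.
rewrite -(fineK (_ : F q \is a fin_num)) ?objective_fin_num//.
rewrite -(fineK (_ : F w \is a fin_num)) ?objective_fin_num//.
rewrite -EFinD lee_fin !fine_objective//.
have qsmall : (2 * gamma)^-1 * enorm (q - w) ^+ 2 <= eps * enorm (q - w).
  rewrite expr2 mulrA ler_wpM2r ?enorm_ge0// mulrC ler_pdivrMr ?mulr_gt0//.
  by rewrite mulrC ltW.
have fq := convex_gradient_le q f_convex (f_diff w).
have := prox_grad_le Tzw gq.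
rewrite (_ : q - z = (q - w) + (w - z)); last by rewrite addrA subrK.
move: (q - w) (w - z) (gradient f w) (gradient f z) fq qsmall.
move=> r e dw dz; rewrite invfM !sqr_enorm !dotE (dotC e r) -!sqr_enorm.
by lra.
Qed.

Lemma prox_grad_subgradient_le z w :
  enorm (gradient f w - gradient f z - gamma^-1 *: (w - z))
  <= (L + gamma^-1) * enorm (w - z).
Proof.
rewrite (le_trans (ler_enormD _ _))// enormN enormZ gtr0_norm ?invr_gt0//.
by rewrite mulrDl lerD2r f_lip.
Qed.

(** The extrapolation error [|v - z| = alpha |v - u|] in the second step is
    paid for by the decrease obtained in the first one. *)
Lemma inertial_descent alpha u v w :
  gamma * L <= 2^-1 -> 0 <= alpha <= 2^-1 -> F u \is a fin_num ->
  prox_grad gamma f g u v ->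
  prox_grad gamma f g (v + alpha *: (v - u)) w ->
  fine (F w) + (1 - gamma * L) / (2 * gamma)
               * enorm (w - (v + alpha *: (v - u))) ^+ 2 <= fine (F u).
Proof.
move=> gL /andP[al0 al1] Fu Tuv Tzw.
have Fv : F v \is a fin_num by rewrite objective_fin_num (prox_grad_fin_num Tuv).
have := prox_grad_descent Tuv Fu; have := prox_grad_descent Tzw Fv.
set z := v + _; rewrite subrr.
have -> : v - z = - (alpha *: (v - u)) by rewrite /z opprD addrA subrr add0r.
rewrite enormN enormZ ger0_norm//.
set d := enorm (v - u); set e := enorm (w - z).
rewrite (_ : enorm 0 = 0); last by rewrite -(scale0r 0) enormZ normr0 mul0r.
have -> : (1 - gamma * L) / (2 * gamma) = (2 * gamma)^-1 - L / 2.
  by field; rewrite gt_eqF.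
(* This is [alpha^2 <= 1 - gamma L], which follows from [1/4 <= 1/2]. *)
have : (2 * gamma)^-1 * (alpha * d) ^+ 2 <= ((2 * gamma)^-1 - L / 2) * d ^+ 2.
  rewrite exprMn mulrA ler_wpM2r ?sqr_ge0//.
  have -> : (2 * gamma)^-1 - L / 2 = (2 * gamma)^-1 * (1 - gamma * L).
    by field; rewrite gt_eqF.
  by rewrite ler_wpM2l ?invr_ge0 ?mulr_ge0 ?ltW//; nra.
by lra.
Qed.

(** The KL inequality at [w], tested on the subgradient produced by the second
    proximal step, bounds [|w - z|] from below; the square of that bound enters
    [inertial_descent]. *)
Lemma KL_inertial_step theta C Fstar alpha u v w :
  0 < C -> theta <= 1 -> 0 <= L ->
  ereal_inf (range F) = Fstar%:E -> KL_property F Fstar theta C ->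
  gamma * L <= 2^-1 -> 0 <= alpha <= 2^-1 -> F u \is a fin_num ->
  prox_grad gamma f g u v ->
  prox_grad gamma f g (v + alpha *: (v - u)) w ->
  0 < fine (F w) - Fstar ->
  (1 - gamma * L) * gamma / (2 * (1 + gamma * L) ^+ 2) / C ^+ 2
    * (fine (F w) - Fstar) `^ (2 * (1 - theta))
  <= (fine (F u) - Fstar) - (fine (F w) - Fstar).
Proof.
move=> C0 th1 L0 Finf KL gL al01 Fu Tuv Tzw Fw0.
have Fw : F w \is a fin_num by rewrite objective_fin_num (prox_grad_fin_num Tzw).
have wNmin : ~ argmin F w.
  move=> wmin; have : (F w <= Fstar%:E)%E.
    by rewrite -Finf; apply: le_ereal_inf_tmp => _ [q _ <-]; exact: wmin.
  by rewrite -(fineK Fw) lee_fin; lra.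
have Fwy : (F w < +oo)%E by rewrite ltey_eq Fw.
have := KL w Fwy wNmin.
set z := v + _ in Tzw *; set t := _ `^ (1 - theta).
have /ereal_inf_lbound dist_le : [set (enorm s)%:E | s in limiting_subdiff F w]
    (enorm (gradient f w - gradient f z - gamma^-1 *: (w - z)))%:E.
  by exists (gradient f w - gradient f z - gamma^-1 *: (w - z));
    [exact: prox_grad_subgradient|].
move=> /le_trans /(_ dist_le); rewrite lee_fin => {dist_le}.
move=> /le_trans /(_ (prox_grad_subgradient_le _ _)) tle.
have t0 : 0 <= t by exact: powR_ge0.
have -> : (fine (F w) - Fstar) `^ (2 * (1 - theta)) = t ^+ 2.
  by rewrite /t mulrC powRrM powR_mulrn// powR_ge0.
have := inertial_descent gL al01 Fu Tuv Tzw; rewrite -/z.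
set e := enorm (w - z) in tle * =>  Fdec; set A := _ / (2 * _).
have gL0 : 0 < 1 + gamma * L by rewrite ltr_wpDr// mulr_ge0// ltW.
have A0 : 0 <= A.
  by rewrite divr_ge0 ?mulr_ge0 ?exprn_ge0 ?(ltW gL0) ?(ltW gamma_gt0)//; lra.
have -> : A / C ^+ 2 * t ^+ 2 = A * (C^-1 * t) ^+ 2.
  by field; rewrite gt_eqF.
apply: (@le_trans _ _ (A * ((L + gamma^-1) * e) ^+ 2)).
  rewrite ler_wpM2l// ler_sqr// nnegrE ?mulr_ge0 ?addr_ge0 ?invr_ge0 ?enorm_ge0//;
    exact: ltW.
rewrite (_ : A * _ = (1 - gamma * L) / (2 * gamma) * e ^+ 2); first by lra.
by rewrite /A; field; rewrite !gt_eqF.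
Qed.

End ProximalGradient.

(** * The iterates *)

Section DecreaseCoefficient.
Context {R : realType}.
Implicit Types (gamma L : R) (alpha : nat -> R).

(** The coefficient [a_k] computed with [alpha = 0], its largest possible
    value. *)
Definition decrease_coef gamma L : R :=
  (1 - gamma * L) * gamma / (2 * (1 + gamma * L) ^+ 2).

Lemma decrease_coef_gt0 gamma L : 0 < gamma -> 0 < L -> gamma * L <= 2^-1 ->
  0 < decrease_coef gamma L.
Proof.
move=> gamma0 L0 gL; have gL0 : 0 < gamma * L by rewrite mulr_gt0.
by rewrite divr_gt0 ?mulr_gt0 ?exprn_gt0//; lra.
Qed.

Lemma acoef_le_decrease_coef gamma L alpha k : 0 < gamma -> 0 < L ->
  0 <= alpha k.*2 -> acoef gamma L alpha k <= decrease_coef gamma L.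
Proof.
move=> gamma0 L0 a0; have gL0 : 0 < gamma * L by rewrite mulr_gt0.
rewrite /acoef /decrease_coef -!mulrA ler_wpM2r//; last by lra.
by rewrite divr_ge0 ?mulr_ge0 ?exprn_ge0 ?(ltW gamma0)//; lra.
Qed.

End DecreaseCoefficient.

Section Recurrence.
Context {R : realType} {n : nat}.
Variables (f : 'rV[R]_n -> R) (g : 'rV[R]_n -> \bar R) (L gamma : R).
Variables (Fstar theta C : R) (alpha : nat -> R) (x y : nat -> 'rV[R]_n).
Hypotheses (f_convex : convex_function [set: 'rV[R]_n] f)
  (f_diff : forall x, differentiable f x) (L_gt0 : 0 < L)
  (f_lip : lipschitz_gradient f L) (g_proper : proper_fun g)
  (FstarE : ereal_inf (range (objective f g)) = Fstar%:E)
  (theta_range : 0 < theta <= 1) (C_gt0 : 0 < C)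
  (F_KL : KL_property (objective f g) Fstar theta C) (gamma_gt0 : 0 < gamma)
  (gammaL : gamma * L <= 2^-1)
  (alpha_range : forall k, 0 <= alpha k <= 2^-1)
  (xy_alg : alternated_inertia gamma alpha f g x y).

Let E (k : nat) : R := fine (objective f g (y k.*2)) - Fstar.

Lemma iterate_fin_num k : objective f g (y k.+1.*2) \is a fin_num.
Proof.
have [|_ _ Ty _] := @xy_alg k.*2; first by rewrite odd_double.
by rewrite doubleS objective_fin_num (prox_grad_fin_num g_proper gamma_gt0 Ty).
Qed.

Lemma iterate_ge_min k : 0 <= E k.+1.
Proof.
rewrite /E subr_ge0 -lee_fin fineK ?iterate_fin_num// -FstarE.
by apply: ereal_inf_lbound; exists (y k.+1.*2).
Qed.

(** The step [k.+1] starts from [x_(2k+2) = y_(2k+2)]; the initial step is left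
    out because [x_0] and [y_0] are unrelated. *)
Lemma iterate_kl_recurrence :
  kl_recurrence E (decrease_coef gamma L / C ^+ 2) (2 * (1 - theta)).
Proof.
have step k : [/\ prox_grad gamma f g (y k.+1.*2) (y k.+1.*2.+1) &
    prox_grad gamma f g
      (y k.+1.*2.+1 + alpha k.+1.*2 *: (y k.+1.*2.+1 - y k.+1.*2)) (y k.+2.*2)].
  have xy : x k.+1.*2 = y k.+1.*2.
    by rewrite doubleS; have [|//] := @xy_alg k.*2; rewrite ?odd_double.
  have [|Ty xz Tz _] := @xy_alg k.+1.*2; first by rewrite odd_double.
  by rewrite xy in Ty; rewrite xz in Tz; rewrite (doubleS k.+1).
split=> k; first exact: iterate_ge_min.
- have [Ty Tz] := step k.
  have := inertial_descent f_convex f_diff f_lip g_proper gamma_gt0 gammaL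
    (alpha_range _) (iterate_fin_num k) Ty Tz.
  have : 0 <= (1 - gamma * L) / (2 * gamma).
    rewrite divr_ge0 ?mulr_ge0 ?(ltW gamma_gt0)// subr_ge0.
    by rewrite (le_trans gammaL)// invf_le1// ler1n.
  move=> c0; have := mulr_ge0 c0 (sqr_ge0 (enorm (y k.+2.*2 -
    (y k.+1.*2.+1 + alpha k.+1.*2 *: (y k.+1.*2.+1 - y k.+1.*2))))).
  by rewrite /E; lra.
- move=> Ek; have [Ty Tz] := step k; have /andP[_ th1] := theta_range.
  exact: (KL_inertial_step f_convex f_diff f_lip g_proper gamma_gt0 C_gt0 th1
    (ltW L_gt0) FstarE F_KL gammaL (alpha_range _) (iterate_fin_num k) Ty Tz).
Qed.

Lemma iterate_cvg : objective f g (y k.*2) @[k --> \oo] --> Fstar%:E.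
Proof.
have b0 : 0 < decrease_coef gamma L / C ^+ 2.
  by rewrite divr_gt0 ?exprn_gt0 ?decrease_coef_gt0.
have q0 : 0 <= 2 * (1 - theta).
  by case/andP: theta_range => _ ?; rewrite mulr_ge0 ?subr_ge0.
apply/fine_cvgP; split.
  by exists 1%N => // -[//|k] _; exact: iterate_fin_num.
have -> : fine \o (fun k => objective f g (y k.*2)) = (fun k => E k + Fstar).
  by apply/funext => k; rewrite /E /= subrK.
rewrite -[X in _ --> X]add0r; apply: cvgD (cvg_cst Fstar).
exact: kl_recurrence_cvg0 b0 q0 iterate_kl_recurrence.
Qed.

Lemma iterate_finite : theta = 1 ->
  \forall k \near \oo, objective f g (y k.*2) = Fstar%:E.
Proof.
move=> th1; have b0 : 0 < decrease_coef gamma L / C ^+ 2.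
  by rewrite divr_gt0 ?exprn_gt0 ?decrease_coef_gt0.
have KL := iterate_kl_recurrence; rewrite th1 subrr mulr0 in KL.
have [N _ EN] := kl_recurrence_finite b0 KL.
exists N.+1 => // -[//|k] Nk; rewrite -(fineK (iterate_fin_num k)); congr _%:E.
by apply/eqP; rewrite -subr_eq0; apply/eqP/EN; exact: ltnW.
Qed.

Lemma iterate_sublinear : theta < 2^-1 ->
  near_dominated E (fun k => k%:R `^ (- (1 - 2 * theta)^-1)).
Proof.
move=> th; apply: (@kl_recurrence_sublinear _ _ (decrease_coef gamma L / C ^+ 2)).
- by rewrite divr_gt0 ?exprn_gt0 ?decrease_coef_gt0.
- by lra.
- have -> : 1 + (1 - 2 * theta) = 2 * (1 - theta) by move: theta => t; ring.
  exact: iterate_kl_recurrence.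
Qed.

Lemma iterate_geometric a :
  0 < a <= decrease_coef gamma L -> 2^-1 <= theta < 1 ->
  near_dominated E (fun k => (C ^+ 2 / (C ^+ 2 + a)) ^+ k).
Proof.
move=> /andP[a0 aA] /andP[th0 th1].
have C20 : 0 < C ^+ 2 by rewrite exprn_gt0.
rewrite (_ : _ / _ = (1 + a / C ^+ 2)^-1); last first.
  by field; rewrite !gt_eqF ?addr_gt0.
apply: (@kl_recurrence_geometric _ _ _ (2 * (1 - theta))).
- by rewrite divr_gt0.
- by apply/andP; split; lra.
- apply: kl_recurrence_le iterate_kl_recurrence.
  by rewrite ler_wpM2r// invr_ge0 ltW.
Qed.

End Recurrence.
(** * Convergence rates *)

Theorem proposition4p2 (R : realType) (n : nat)
  (f : 'rV[R]_n -> R) (g : 'rV[R]_n -> \bar R) (L : R)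
  (f_convex : convex_function [set: 'rV[R]_n] f)
  (f_diff : forall x, differentiable f x)
  (L_gt0 : 0 < L) (f_lip : lipschitz_gradient f L)
  (g_proper : proper_fun g) (g_lsc : lower_semicontinuous g)
  (argmin_neq0 : argmin (objective f g) !=set0)
  (argmin_closed : closed (argmin (objective f g)))
  (Fstar : R) (FstarE : ereal_inf (range (objective f g)) = Fstar%:E)
  (theta C : R) (theta_range : 0 < theta <= 1) (C_gt0 : 0 < C)
  (F_KL : KL_property (objective f g) Fstar theta C)
  (gamma : R) (gamma_gt0 : 0 < gamma)
  (alpha : nat -> R) (alpha_range : forall k, 0 <= alpha k <= 2^-1)
  (x y : nat -> 'rV[R]_n)
  (xy_alg : alternated_inertia gamma alpha f g x y) :
  [/\ (* (a) *)
      (gamma < (2 * L)^-1 \/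
       gamma = (2 * L)^-1 /\
       exists2 alphabar : R, alphabar < 2^-1 & forall k, alpha k <= alphabar) ->
      [/\ objective f g (y k.*2) @[k --> \oo] --> Fstar%:E,
          exists2 a : R, 0 < a &
            forall k, (1 <= k)%N -> a <= acoef gamma L alpha k &
          forall a : R, 0 < a ->
            (forall k, (1 <= k)%N -> a <= acoef gamma L alpha k) ->
          [/\ theta < 2^-1 ->
                (fun k => fine (objective f g (y k.*2)) - Fstar : R) =O_\oo
                (fun k => k%:R `^ (- (1 + 2 * theta / (1 - 2 * theta))) : R),
              2^-1 <= theta < 1 ->
                (fun k => fine (objective f g (y k.*2)) - Fstar : R) =O_\oo
                (fun k => (C ^+ 2 / (C ^+ 2 + a)) ^+ k : R) &
              theta = 1 ->
                \forall k \near \oo, objective f g (y k.*2) = Fstar%:E]],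
      (* (b) *)
      forall d : R, 0 < d < 1 -> gamma = (2 * L)^-1 ->
      converges_half_at_rate alpha d ->
      objective f g (y k.*2) @[k --> \oo] --> Fstar%:E /\
      [/\ theta < 2^-1 ->
            (fun k => fine (objective f g (y k.*2)) - Fstar : R) =O_\oo
            (fun k =>
               k%:R `^ (- (1 + (2 * theta - d) / (1 - 2 * theta))) : R),
          2^-1 <= theta < 1 ->
            (fun k => fine (objective f g (y k.*2)) - Fstar : R) =O_\oo
            (fun k => expR (- (Cprime gamma L C alpha d / (2 * C ^+ 2)
                               * k%:R `^ (1 - d))) : R) &
          theta = 1 ->
            \forall k \near \oo, objective f g (y k.*2) = Fstar%:E] &
      (* (c) *)
      gamma = (2 * L)^-1 -> converges_half_at_rate alpha 1 ->
      objective f g (y k.*2) @[k --> \oo] --> Fstar%:E /\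
      [/\ theta < 2^-1 ->
            (fun k => fine (objective f g (y k.*2)) - Fstar : R) =O_\oo
            (fun k => ln k%:R `^ (- (1 - 2 * theta)^-1) : R),
          2^-1 <= theta < 1 ->
            (fun k => fine (objective f g (y k.*2)) - Fstar : R) =O_\oo
            (fun k => k%:R `^ (- (Csecond gamma L C alpha / (2 * C ^+ 2)))
                      : R) &
          theta = 1 ->
            \forall k \near \oo, objective f g (y k.*2) = Fstar%:E]].
Proof.
have C20 : 0 < C ^+ 2 by rewrite exprn_gt0.
have halfL : (2 * L)^-1 * L = 2^-1 by field; rewrite gt_eqF.
have F_cvg (gL : gamma * L <= 2^-1) :=
  iterate_cvg f_convex f_diff L_gt0 f_lip g_proper FstarE theta_range C_gt0
    F_KL gamma_gt0 gL alpha_range xy_alg.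
have F_finite (gL : gamma * L <= 2^-1) :=
  iterate_finite f_convex f_diff L_gt0 f_lip g_proper FstarE theta_range C_gt0
    F_KL gamma_gt0 gL alpha_range xy_alg.
have F_sublinear (gL : gamma * L <= 2^-1) :=
  iterate_sublinear f_convex f_diff L_gt0 f_lip g_proper FstarE theta_range C_gt0
    F_KL gamma_gt0 gL alpha_range xy_alg.
have F_geometric (gL : gamma * L <= 2^-1) :=
  iterate_geometric f_convex f_diff L_gt0 f_lip g_proper FstarE theta_range C_gt0
    F_KL gamma_gt0 gL alpha_range xy_alg.
set A := decrease_coef gamma L.
(* The geometric ratio of regimes (b) and (c), where no [a] is given. *)
have ratio01 : gamma * L <= 2^-1 -> 0 < C ^+ 2 / (C ^+ 2 + A) < 1.
  move=> gL; have A0 : 0 < A by exact: decrease_coef_gt0.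
  by rewrite divr_gt0 ?addr_gt0//= ltr_pdivrMr ?addr_gt0// mul1r ltrDl.
have A01 : gamma * L <= 2^-1 -> 0 < A <= A.
  by move=> gL; rewrite decrease_coef_gt0/=.
split.
- move=> gamma_alpha.
  have gL : gamma * L <= 2^-1.
    rewrite -halfL ler_pM2r//.
    by case: gamma_alpha => [/ltW//|[-> _]].
  split; first exact: F_cvg.
    have gL0 : 0 < gamma * L by rewrite mulr_gt0.
    have D0 : 0 < gamma / (2 * (1 + gamma * L) ^+ 2).
      by rewrite divr_gt0// mulr_gt0// exprn_gt0//; lra.
    case: gamma_alpha => [gammaL|[gammaE [abar abar2 alphale]]].
      exists ((2^-1 - gamma * L) * (gamma / (2 * (1 + gamma * L) ^+ 2))).
        by rewrite mulr_gt0// subr_gt0 -halfL ltr_pM2r.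
      move=> k _; rewrite /acoef -[leRHS]mulrA ler_pM2r//.
      by have /andP[_] := alpha_range k.*2; lra.
    exists ((2^-1 - abar) * (gamma / (2 * (1 + gamma * L) ^+ 2))).
      by rewrite mulr_gt0// subr_gt0.
    move=> k _; rewrite /acoef -[leRHS]mulrA ler_pM2r//.
    by have := alphale k.*2; have := gL; lra.
  move=> a a0 aa; have aA : 0 < a <= A.
    rewrite a0 (le_trans (aa 1%N _))// acoef_le_decrease_coef//.
    by case/andP: (alpha_range 1.*2).
  split.
  + move=> th; have := F_sublinear gL th.
    move=> /near_dominated_eqO; apply; apply: nearW => k.
    rewrite (_ : 1 + 2 * theta / _ = (1 - 2 * theta)^-1)//.
    by field; lra.
  + move=> th; have := F_geometric gL _ aA th.
    by move=> /near_dominated_eqO; apply; apply: nearW => k.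
  + exact: F_finite.
- move=> d /andP[d0 d1] gammaE _; have gL : gamma * L <= 2^-1.
    by rewrite gammaE halfL.
  split; first exact: F_cvg.
  split.
  + move=> th; have := F_sublinear gL th.
    move=> /near_dominated_eqO; apply; exists 1%N => // k /= k1.
    rewrite ler_powR ?ler1n// lerN2.
    rewrite (_ : 1 + (2 * theta - d) / _ = (1 - d) / (1 - 2 * theta)); last by field; lra.
    by rewrite -[leRHS]mul1r ler_wpM2r ?invr_ge0; lra.
  + move=> th; have := F_geometric gL _ (A01 gL) th.
    move=> /near_dominated_eqO; apply.
    exact: geometric_le_expR_powR (ratio01 gL) d0.
  + exact: F_finite.
- move=> gammaE _; have gL : gamma * L <= 2^-1 by rewrite gammaE halfL.
  split; first exact: F_cvg.
  split.
  + move=> th; have := F_sublinear gL th.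
    move=> /near_dominated_eqO; apply.
    by apply: powRN_le_ln; rewrite invr_gt0; lra.
  + move=> th; have := F_geometric gL _ (A01 gL) th.
    move=> /near_dominated_eqO; apply.
    exact: geometric_le_powRN (ratio01 gL).
  + exact: F_finite.
Qed.
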